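(* Fix an imprecise probabilities tree with finite state space $\mathscr{X}$, and let $\overline{\mathrm{E}}_{\mathrm V}$ be the corresponding game-theoretic upper expectation. For any situation $s\in\mathscr{X}^{\ast}$ and any sequence $\{f_n\}_{n\in\mathbb{N}_0}$ in $\overline{\mathscr{L}}_b(\Omega)$ that is uniformly bounded below (there is $M\in\mathbb{R}$ with $f_n\ge M$ for all $n\in\mathbb{N}_0$), we have that \[\overline{\mathrm{E}}_{\mathrm V}(f\vert s)\le\liminf_{n\to+\infty}\overline{\mathrm{E}}_{\mathrm V}(f_n\vert s),\quad\text{where } f=\liminf_{n\to+\infty}f_n \text{ (pointwise)}.\]
   Context: Notation: $\mathbb{N}=\{1,2,\dots\}$, $\mathbb{N}_0=\mathbb{N}\cup\{0\}$, $\overline{\mathbb{R}}=\mathbb{R}\cup\{-\infty,+\infty\}$, with conventions $+\infty-\infty=-\infty+\infty=+\infty$, $0\cdot(\pm\infty)=0$, $\inf\emptyset=+\infty$. For a non-empty set $\mathscr{Y}$, $\overline{\mathscr{L}}(\mathscr{Y})$ is the set of all maps $\mathscr{Y}\to\overline{\mathbb{R}}$ and $\overline{\mathscr{L}}_b(\mathscr{Y})$ the subset of those bounded below by a real constant. Limits and inequalities of functions are pointwise. Local models: $\mathscr{X}$ is a finite non-empty set. $\mathscr{X}^{\ast}=\bigcup_{n\in\mathbb{N}_0}\mathscr{X}^n$ is the set of situations (finite strings, including the empty string $\Box$). An imprecise probabilities tree assigns to each $s\in\mathscr{X}^{\ast}$ a map $\overline{\mathrm{Q}}_s\colon\overline{\mathscr{L}}(\mathscr{X})\to\overline{\mathbb{R}}$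 that is an upper expectation, i.e. satisfies: (E1) $\overline{\mathrm{Q}}_s(c)=c$ for all $c\in\mathbb{R}$; (E2) $\overline{\mathrm{Q}}_s(f+g)\le\overline{\mathrm{Q}}_s(f)+\overline{\mathrm{Q}}_s(g)$ for all $f,g\in\overline{\mathscr{L}}_b(\mathscr{X})$; (E3) $\overline{\mathrm{Q}}_s(\lambda f)=\lambda\overline{\mathrm{Q}}_s(f)$ for all real $\lambda>0$ and $f\in\overline{\mathscr{L}}_b(\mathscr{X})$; (E4) $f\le g\Rightarrow\overline{\mathrm{Q}}_s(f)\le\overline{\mathrm{Q}}_s(g)$ for all $f,g\in\overline{\mathscr{L}}_b(\mathscr{X})$; (E5) $\lim_n\overline{\mathrm{Q}}_s(f_n)=\overline{\mathrm{Q}}_s(\lim_n f_n)$ for every non-decreasing sequence $\{f_n\}_{n\in\mathbb{N}_0}$ of non-negative variables in $\overline{\mathscr{L}}_b(\mathscr{X})$. Global model: $\Omega=\mathscr{X}^{\mathbb{N}}$ is the set of paths; for $\omega\in\Omega$, $\omega^n\in\mathscr{X}^n$ is the string of its first $n$ values; $\Gamma(x_{1:n})=\{\omega\in\Omega:\omega^n=x_{1:n}\}$. For $g,h\colon\Omega\to\overline{\mathbb{R}}$, $g\ge_s h$ means $g(\omega)\ge h(\omega)$ for all $\omega\in\Gamma(s)$. A supermartingale is a map $\mathscr{M}\colon\mathscr{X}^{\ast}\to\overline{\mathbb{R}}$ with $\overline{\mathrm{Q}}_s(\mathscr{M}(s\,\cdot))\le\mathscr{M}(s)$ for all $s\in\mathscr{X}^{\ast}$,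 where $\mathscr{M}(s\,\cdot)\in\overline{\mathscr{L}}(\mathscr{X})$ is $x\mapsto\mathscr{M}(sx)$. $\overline{\mathbb{M}}_{\mathrm b}$ is the set of supermartingales bounded below by a real constant, and $\liminf\mathscr{M}(\omega)=\liminf_{n\to+\infty}\mathscr{M}(\omega^n)$. The game-theoretic upper expectation is, for all $f\colon\Omega\to\overline{\mathbb{R}}$ and $s\in\mathscr{X}^{\ast}$, \[\overline{\mathrm{E}}_{\mathrm V}(f\vert s)=\inf\{\mathscr{M}(s):\mathscr{M}\in\overline{\mathbb{M}}_{\mathrm b},\ \liminf\mathscr{M}\ge_s f\}.\] *)

(* Defs.v *)
From HB Require Import structures.
From mathcomp Require Import all_boot all_order all_algebra.
From mathcomp Require Import all_classical all_reals all_analysis.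
Import Order.TTheory GRing.Theory Num.Theory.
Import numFieldNormedType.Exports.

Set Implicit Arguments.
Unset Strict Implicit.
Unset Printing Implicit Defensive.

Local Open Scope classical_set_scope.
Local Open Scope ring_scope.
Local Open Scope ereal_scope.

Definition bounded_below_by_real (R : realType) (Y : Type) (f : Y -> \bar R) :
    Prop :=
  exists c : R, forall y, c%:E <= f y.

(* The addition [+%dE] is the one for which +oo - oo = -oo + oo = +oo.
   Nothing is required of [Q] at non-constant maps that are not bounded
   below.  The pointwise limit in [ue_continuous] always exists in [\bar R],
   since the sequence is non-decreasing. *)
Record upper_expectation (R : realType) (X : finType)
    (Q : (X -> \bar R) -> \bar R) : Prop := UpperExpectation {
  ue_const : forall c : R, Q (fun=> c%:E) = c%:E;
  ue_subadditive : forall f g : X -> \bar R,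
    bounded_below_by_real f -> bounded_below_by_real g ->
    Q (fun x => f x + g x)%dE <= (Q f + Q g)%dE;
  ue_homogeneous : forall (l : R) (f : X -> \bar R),
    (0 < l)%R -> bounded_below_by_real f ->
    Q (fun x => l%:E * f x) = l%:E * Q f;
  ue_monotone : forall f g : X -> \bar R,
    bounded_below_by_real f -> bounded_below_by_real g ->
    (forall x, f x <= g x) -> Q f <= Q g;
  ue_continuous : forall f : nat -> X -> \bar R,
    (forall n, bounded_below_by_real (f n)) ->
    (forall n x, 0 <= f n x) ->
    (forall n x, f n x <= f n.+1 x) ->
    Q (f n) @[n --> \oo] --> Q (fun x => limn (fun n => f n x))
}.

(* A situation is a finite string [s : seq X]; the string s x is [rcons s x]. *)
Definition imprecise_probabilities_tree (R : realType) (X : finType)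
    (Q : seq X -> (X -> \bar R) -> \bar R) : Prop :=
  forall s, upper_expectation (Q s).

(* The k-th value of a path (k >= 1) is [w k.-1], so that the string of the
   first n values of [w] is [mkseq w n]. *)
Definition path_space (X : finType) : Type := nat -> X.

Definition prefix_of_path (X : finType) (w : path_space X) (n : nat) : seq X :=
  mkseq w n.

Definition cylinder (X : finType) (s : seq X) : set (path_space X) :=
  [set w | prefix_of_path w (size s) = s].

Definition supermartingale (R : realType) (X : finType)
    (Q : seq X -> (X -> \bar R) -> \bar R) (M : seq X -> \bar R) : Prop :=
  forall s, Q s (fun x => M (rcons s x)) <= M s.

Definition liminf_along (R : realType) (X : finType) (M : seq X -> \bar R)
    (w : path_space X) : \bar R :=
  limn_einf (fun n => M (prefix_of_path w n)).

Definition game_upper_expectation (R : realType) (X : finType)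
    (Q : seq X -> (X -> \bar R) -> \bar R)
    (f : path_space X -> \bar R) (s : seq X) : \bar R :=
  ereal_inf [set M s | M in [set M : seq X -> \bar R |
    [/\ supermartingale Q M, bounded_below_by_real M &
        forall w, cylinder s w -> f w <= liminf_along M w]]].

(* Main.v *)
Require Import Defs.
From HB Require Import structures.
From mathcomp Require Import all_boot all_order all_algebra.
From mathcomp Require Import all_classical all_reals all_analysis.
Import Order.TTheory GRing.Theory Num.Theory.
Import numFieldNormedType.Exports.

Set Implicit Arguments.
Unset Strict Implicit.
Unset Printing Implicit Defensive.

Local Open Scope classical_set_scope.
Local Open Scope ring_scope.
Local Open Scope ereal_scope.

(* Write E for the game-theoretic upper expectation. The maps
   g_n = inf_(k >= n) f_k increase to f, and E(g_n | s) <= E(f_k | s) for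
   k >= n, so it suffices that E is continuous along nondecreasing sequences
   that are uniformly bounded below. By (E5), c = sup_n E(g_n | .) is a
   supermartingale. By a version of Levy's zero-one law, a supermartingale T
   with T(s) arbitrarily small tends to +oo on all paths w through s with
   liminf_k E(g_n | w^k) < g_n(w) for some n; hence c + T superhedges sup_n g_n.

   Levy's law reduces to the event N where liminf_k E(g | w^k) < a < b < g(w),
   with g >= m and m < a. If the upper probability of N is at most C in every
   situation, then it is at most C (a - m) / (b - m): wait for a situation t
   with E(g | t) < a, then scale a superhedge of g started below a and stop it
   when it exceeds b. The supremum over all situations is therefore 0. *)

(** * Limits inferior, rational interpolation and prefixes of paths *)

Lemma near_le_limn_einf (R : realType) (u v : nat -> \bar R) :
  (\forall n \near \oo, u n <= v n) -> limn_einf u <= limn_einf v.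
Proof.
move=> [N _ uv]; rewrite !limn_einf_lim.
apply: lee_lim; [exact: is_cvg_einfs|exact: is_cvg_einfs|].
exists N => // n /= Nn; apply: le_ereal_inf_tmp => _ [k /= nk <-].
apply: le_trans (uv k (leq_trans Nn nk)).
by apply: ereal_inf_lbound; exists k.
Qed.

Lemma limn_einf_cst (R : realType) (c : \bar R) :
  limn_einf (fun=> c) = c.
Proof. by have [-> _] := cvg_limn_einf_sup (@cvg_cst _ c _ \oo _). Qed.

Lemma limn_einfE (R : realType) (u : nat -> \bar R) :
  limn_einf u = ereal_sup (range (fun n => einfs u n)).
Proof. by rewrite limn_einf_lim; apply/cvg_lim => //; exact: cvg_einfs_sup. Qed.

Lemma rat_between_ereal (R : realType) (x y : \bar R) :
  x < y -> exists q : rat, x < (ratr q)%:E < y.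
Proof.
have H (a b : R) : (a < b)%R -> exists q : rat, a%:E < (ratr q)%:E < b%:E.
  move=> /rat_in_itvoo[q]; rewrite in_itv /= => /andP[aq qb].
  by exists q; rewrite !lte_fin aq qb.
case: x y => [x| |] [y| |] //= xy.
- exact: H.
- have [|q /andP[xq _]] := H x (x + 1)%R; first by rewrite ltrDl.
  by exists q; rewrite xq ltry.
- have [|q /andP[_ qy]] := H (y - 1)%R y; first by rewrite ltrBlDr ltrDl.
  by exists q; rewrite qy ltNyr.
- by exists 0%R; rewrite ltNyr ltry.
Qed.

Lemma take_mkseq (T : Type) (w : nat -> T) m n :
  (m <= n)%N -> take m (mkseq w n) = mkseq w m.
Proof. by move=> mn; rewrite /mkseq -map_take take_iota (minn_idPl mn). Qed.

Lemma prefix_of_cylinder (X : finType) (s : seq X) (w : path_space X) n :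
  cylinder s w -> (size s <= n)%N -> prefix s (prefix_of_path w n).
Proof.
by move=> sw sn; rewrite prefixE -[X in _ == X]sw /prefix_of_path take_mkseq.
Qed.

Lemma sub_cylinder (X : finType) (s t : seq X) (w : path_space X) :
  prefix s t -> cylinder t w -> cylinder s w.
Proof.
move=> st tw; have /prefixP[r tE] := st.
rewrite /cylinder /= -{2}(take_size_cat r (erefl (size s))) -tE -tw.
by rewrite /prefix_of_path take_mkseq // tE size_cat leq_addr.
Qed.

(** * Consequences of (E1) to (E5) for a single local model *)

Section LocalModel.
Context (R : realType) (X : finType).
Implicit Types (Q : (X -> \bar R) -> \bar R) (f g : X -> \bar R).

Lemma ue_ge_cst Q f (c : R) : upper_expectation Q ->
  (forall x, c%:E <= f x) -> c%:E <= Q f.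
Proof.
move=> hQ cf; rewrite -{1}(ue_const hQ c).
by apply: (ue_monotone hQ) => //; exists c.
Qed.

(** The two additions differ only at +oo - oo. This never occurs here: [f] and [g] lie above real
    constants, and [ue_ge_cst] carries these bounds over to [Q f] and [Q g]. *)
Lemma ue_subadd Q f g : upper_expectation Q ->
  bounded_below_by_real f -> bounded_below_by_real g ->
  Q (fun x => f x + g x) <= Q f + Q g.
Proof.
have dE (a b : R) (x y : \bar R) : a%:E <= x -> b%:E <= y -> (x + y)%dE = x + y.
  by case: x y => [x| |] [y| |].
move=> hQ bf bg; have [[a af] [b bg']] := (bf, bg).
rewrite -(dE a b); [|exact: ue_ge_cst|exact: ue_ge_cst].
apply: le_trans (ue_subadditive hQ bf bg); rewrite le_eqVlt; apply/orP; left.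
by apply/eqP; congr Q; apply/funext => x; rewrite (dE a b).
Qed.

Lemma ue_affine_le Q f (l d : R) : upper_expectation Q ->
  bounded_below_by_real f -> (0 < l)%R ->
  Q (fun x => l%:E * f x + d%:E) <= l%:E * Q f + d%:E.
Proof.
move=> hQ bf l0; have [c cf] := bf.
apply: (le_trans (@ue_subadd _ (fun x => l%:E * f x) (fun=> d%:E) hQ _ _)).
- by exists (l * c)%R => x; rewrite EFinM lee_pmul2l.
- by exists d.
by rewrite (ue_const hQ) (ue_homogeneous hQ).
Qed.

(** (E5) concerns non-negative sequences, so [F] is translated by [- m]; [ue_affine_le] handles both
    this shift and the shift back. *)
Lemma ue_sup_le Q (F : nat -> X -> \bar R) (m : R) : upper_expectation Q ->
  (forall n x, m%:E <= F n x) -> (forall n x, F n x <= F n.+1 x) ->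
  Q (fun x => ereal_sup (range (fun n => F n x))) <=
  ereal_sup (range (fun n => Q (F n))).
Proof.
move=> hQ mF Fnd.
pose G n x := 1%:E * F n x + (- m)%:E.
have G0 n x : 0 <= G n x.
  by rewrite /G mul1e EFinN sube_ge0 ?mF// fin_numE.
have Gnd n x : G n x <= G n.+1 x by rewrite /G !mul1e leeD2r.
have bF n : bounded_below_by_real (F n) by exists m.
have bG n : bounded_below_by_real (G n) by exists 0%R.
have cvG x : limn (fun n => G n x) = ereal_sup (range (fun n => G n x)).
  apply/cvg_lim => //; apply: ereal_nondecreasing_cvgn.
  by apply/nondecreasing_seqP => n; exact: Gnd.
have bL : bounded_below_by_real (fun x => limn (fun n => G n x)).
  exists 0%R => x; rewrite cvG; apply: le_ereal_sup_tmp.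
  by exists (G 0%N x) => //; exists 0%N.
apply: (@le_trans _ _ (Q (fun x => 1%:E * limn (fun n => G n x) + m%:E))).
  apply: (ue_monotone hQ).
  - exists m => x; apply: le_ereal_sup_tmp.
    by exists (F 0%N x) => //; exists 0%N.
  - have [c cL] := bL; exists (c + m)%R => x.
    by rewrite EFinD mul1e leeD2r.
  - move=> x; apply: ge_ereal_sup => _ [n _ <-].
    rewrite mul1e cvG -leeBlDr//; apply: le_ereal_sup_tmp.
    by exists (G n x); [exists n|rewrite /G mul1e].
apply: le_trans (@ue_affine_le _ _ _ m hQ bL ltr01) _; rewrite mul1e.
rewrite -leeBrDr//.
apply: (cvge_to_le (ue_continuous hQ bG G0 Gnd)); apply: nearW => n.
apply: le_trans (@ue_affine_le _ _ _ (- m) hQ (bF n) ltr01) _.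
by rewrite mul1e EFinN leeD2r//; apply: ereal_sup_ubound; exists n.
Qed.

End LocalModel.

(** * Supermartingales bounded below *)

Section Supermartingales.
Context (R : realType) (X : finType) (Q : seq X -> (X -> \bar R) -> \bar R).
Context (hX : (0 < #|X|)%N) (hQ : imprecise_probabilities_tree Q).
Implicit Types (M : seq X -> \bar R) (s t u : seq X) (w : path_space X).
Implicit Types (f g h : path_space X -> \bar R).

Lemma supermartingale_affine M (l d : R) : (0 < l)%R ->
  bounded_below_by_real M -> supermartingale Q M ->
  supermartingale Q (fun u => l%:E * M u + d%:E).
Proof.
move=> l0 [c cM] smM s.
apply: (le_trans (@ue_affine_le _ _ _ (fun x => M (rcons s x)) _ d (hQ s) _ l0)).
  by exists c.
by rewrite leeD2r// lee_pmul2l.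
Qed.

Lemma bounded_below_affine M (l d : R) : (0 < l)%R ->
  bounded_below_by_real M ->
  bounded_below_by_real (fun u => l%:E * M u + d%:E).
Proof.
move=> l0 [c cM]; exists (l * c + d)%R => u.
by rewrite EFinD EFinM leeD2r// lee_pmul2l.
Qed.

Lemma supermartingale_cst (a : \bar R) : -oo < a -> supermartingale Q (fun=> a).
Proof.
by case: a => [a| |] // _ s; [rewrite (ue_const (hQ s))|exact: leey].
Qed.

Lemma supermartingale_sup (M : nat -> seq X -> \bar R) (m : R) :
  (forall n, supermartingale Q (M n)) -> (forall n u, m%:E <= M n u) ->
  (forall n u, M n u <= M n.+1 u) ->
  supermartingale Q (fun u => ereal_sup (range (fun n => M n u))).
Proof.
move=> smM mM Mnd s.
apply: le_trans (@ue_sup_le _ _ _ (fun n x => M n (rcons s x)) m (hQ s) _ _) _ => //.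
apply: ge_ereal_sup => _ [n _ <-]; apply: le_trans (smM n s) _.
by apply: ereal_sup_ubound; exists n.
Qed.

Lemma supermartingale_add (M N : seq X -> \bar R) :
  bounded_below_by_real M -> bounded_below_by_real N ->
  supermartingale Q M -> supermartingale Q N ->
  supermartingale Q (fun u => M u + N u).
Proof.
move=> [m mM] [n nN] smM smN s.
apply: le_trans (@ue_subadd _ _ _ (fun x => M (rcons s x))
  (fun x => N (rcons s x)) (hQ s) _ _) _; [by exists m|by exists n|].
exact: leeD.
Qed.

(** Since [X] is finite, the least child value is attained. If it exceeded [M u], a rational
    constant would fit strictly between, and the local upper expectation would be at least that
    constant. *)
Lemma supermartingale_descent M u : bounded_below_by_real M ->
  supermartingale Q M -> exists x, M (rcons u x) <= M u.
Proof.
move=> [c cM] smM; apply: contrapT => /forallNP nle.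
have [x0 _] : exists x0 : X, true by move/card_gt0P: hX => [x0 _]; exists x0.
have [x _ xmin] := @arg_minP _ _ _ x0 xpredT (fun x => M (rcons u x)) isT.
have lt_ux : M u < M (rcons u x) by rewrite ltNge; apply/negP/nle.
have [q /andP[uq qx]] := rat_between_ereal lt_ux.
have := le_trans (@ue_ge_cst _ _ _ (fun x => M (rcons u x)) (ratr q) (hQ u) _) (smM u).
rewrite leNgt uq => /(_ _)/negP; apply => //.
by move=> y; exact: le_trans (ltW qx) (xmin y isT).
Qed.

(** Repeated descent from [t] builds a path in the cylinder along which [M] never exceeds [M t]. *)
Lemma supermartingale_ge_liminf M t (m : \bar R) : bounded_below_by_real M ->
  supermartingale Q M ->
  (forall w, cylinder t w -> m <= liminf_along M w) -> m <= M t.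
Proof.
move=> bM smM mM.
have [step stepP] := choice (fun u => supermartingale_descent u bM smM).
pose U k := iter k (fun u => rcons u (step u)) t.
pose w : path_space X :=
  fun i => if (i < size t)%N then nth (step [::]) t i else step (U (i - size t)%N).
have wU k : prefix_of_path w (size t + k) = U k.
  elim: k => [|k IH].
    rewrite addn0 -[RHS](mkseq_nth (step [::])); apply/eq_in_map => i.
    by rewrite mem_iota /= add0n /w => ->.
  by rewrite addnS /prefix_of_path mkseqS -/(prefix_of_path _ _) IH /w
    ltnNge leq_addr addKn.
apply: le_trans (mM w _) _; first by rewrite /cylinder /= -(addn0 (size t)) wU.
rewrite -[leRHS](@limn_einf_cst R); apply: near_le_limn_einf.
exists (size t) => // n /= tn; rewrite -(subnKC tn) wU.
elim: (n - size t)%N => //= k; exact: le_trans (stepP _).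
Qed.

(** Outside the subtree of [s] the inequality is trivial because its right side is +oo; inside, all
    children stay in the subtree. *)
Lemma supermartingale_restrict M s : supermartingale Q M ->
  supermartingale Q (fun u => if prefix s u then M u else +oo).
Proof.
move=> smM u; case: ifPn => [su|_]; last exact: leey.
rewrite (_ : (fun x => _) = fun x => M (rcons u x)); first exact: smM.
by apply/funext => x; rewrite (prefix_trans su (prefix_rcons u x)).
Qed.

(** * The game-theoretic upper expectation: bounds, supermartingale property, switching *)

Local Notation E := (game_upper_expectation Q).

Lemma game_upper_le f s M : supermartingale Q M -> bounded_below_by_real M ->
  (forall w, cylinder s w -> f w <= liminf_along M w) -> E f s <= M s.
Proof. by move=> smM bM fM; apply: ereal_inf_lbound; exists M. Qed.

Lemma game_upper_ge f s (m : \bar R) :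
  (forall w, cylinder s w -> m <= f w) -> m <= E f s.
Proof.
move=> mf; apply: le_ereal_inf_tmp => _ [M [smM bM fM] <-].
by apply: supermartingale_ge_liminf => // w sw; exact: le_trans (mf w sw) (fM w sw).
Qed.

Lemma game_upper_le_cst f s (a : \bar R) : -oo < a ->
  (forall w, cylinder s w -> f w <= a) -> E f s <= a.
Proof.
move=> a0 fa; apply: (@game_upper_le _ _ (fun=> a)).
- exact: supermartingale_cst.
- case: a a0 {fa} => [a| |] // _; first by exists a.
  by exists 0%R => _; exact: leey.
- by move=> w sw; rewrite /liminf_along limn_einf_cst; exact: fa.
Qed.

Lemma game_upper_mono f g s :
  (forall w, cylinder s w -> f w <= g w) -> E f s <= E g s.
Proof.
move=> fg; apply: le_ereal_inf_tmp => _ [M [smM bM gM] <-].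
by apply: game_upper_le => // w sw; exact: le_trans (fg w sw) (gM w sw).
Qed.

(** A superhedge of [f] from [s] is also one from each child of [s], so it dominates [E f] there. *)
Lemma game_upper_supermartingale f (m : R) : (forall w, m%:E <= f w) ->
  supermartingale Q (E f).
Proof.
move=> mf s; apply: le_ereal_inf_tmp => _ [M [smM bM fM] <-].
apply: le_trans (smM s); have [c cM] := bM.
apply: (ue_monotone (hQ s)); [|by exists c|].
  by exists m => x; exact: game_upper_ge.
move=> x; apply: game_upper_le => // w sxw; apply: fM.
exact: sub_cylinder (prefix_rcons s x) sxw.
Qed.

(** Provides a near-optimal superhedge with the same lower bound [m] as [f]. A superhedge from [s]
    is at least [m] on the subtree of [s], by [supermartingale_ge_liminf]; elsewhere it is reset to
    +oo. *)
Lemma game_upper_ltP f s (m : R) (a : \bar R) : (forall w, m%:E <= f w) ->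
  E f s < a -> exists M, [/\ supermartingale Q M, forall u, m%:E <= M u,
    M s < a & forall w, cylinder s w -> f w <= liminf_along M w].
Proof.
move=> mf /ereal_inf_lt[_ [M [smM bM fM] <-] Ma].
exists (fun u => if prefix s u then M u else +oo); split.
- exact: supermartingale_restrict.
- move=> u; case: ifPn => su; last exact: leey.
  apply: supermartingale_ge_liminf => // w uw.
  exact: le_trans (mf w) (fM w (sub_cylinder su uw)).
- by rewrite prefix_refl.
- move=> w sw; apply: le_trans (fM w sw) _; apply: near_le_limn_einf.
  by exists (size s) => // n /= sn; rewrite (prefix_of_cylinder sw sn).
Qed.

(** Ordered by length, from the empty string to [u] itself, so that the head of the list filtered by
    [D] is the first entry into [D]. *)
Definition prefixes u := mkseq (take^~ u) (size u).+1.

Lemma prefixes_rcons u x : prefixes (rcons u x) = rcons (prefixes u) (rcons u x).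
Proof.
rewrite /prefixes size_rcons mkseqS; congr rcons.
  apply/eq_in_map => n; rewrite mem_iota /= add0n ltnS => nu.
  by rewrite -cats1 takel_cat.
by rewrite take_oversize // size_rcons.
Qed.

Lemma prefixes_path w n :
  prefixes (prefix_of_path w n) = mkseq (prefix_of_path w) n.+1.
Proof.
rewrite /prefixes size_mkseq; apply/eq_in_map => k.
by rewrite mem_iota /= add0n ltnS => kn; rewrite /prefix_of_path take_mkseq.
Qed.

(* The hedging strategy switches, the first time [D] is entered, from [M] to
   a nearly optimal strategy [K t] for the situation [t] just reached. *)
Lemma game_upper_le_cut f s M (D : pred (seq X)) (m : R) :
  (forall w, m%:E <= f w) -> supermartingale Q M -> bounded_below_by_real M ->
  (forall t, D t -> prefix s t) -> (forall t, D t -> E f t <= M t) ->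
  (forall w, cylinder s w -> (forall n, ~~ D (prefix_of_path w n)) ->
     f w <= liminf_along M w) ->
  E f s <= M s.
Proof.
move=> mf smM bM Ds EM fM; apply/lee_addgt0Pr => e e0; have [c cM] := bM.
have KP t : exists K : seq X -> \bar R, D t ->
    [/\ supermartingale Q K, forall u, m%:E <= K u, K t <= M t + e%:E &
        forall w, cylinder t w -> f w <= liminf_along K w].
  have [Dt|] := boolP (D t); last by exists (fun=> +oo).
  (* At an infinite value the margin [e] gives no strict inequality, so the constant +oo serves as
     strategy. *)
  have [Moo|Mfin] := eqVneq (M t) +oo.
    exists (fun=> +oo) => _; split=> //.
    - exact: supermartingale_cst.
    - by move=> _; exact: leey.
    - by rewrite Moo.
    - by move=> w _; rewrite /liminf_along limn_einf_cst; exact: leey.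
  have [|K [smK mK Kt fK]] := @game_upper_ltP f t m (M t + e%:E) mf.
    apply: le_lt_trans (EM t Dt) _; rewrite lteDl ?lte_fin//.
    rewrite fin_numE Mfin andbT -ltNye.
    exact: lt_le_trans (ltNyr c) (cM t).
  by exists K => _; split=> //; exact: ltW.
have [K {}KP] := choice KP.
(* The head [t] is the situation of first entry. Before it, the surplus [e] is carried along to pay
   for the start of [K t], at most [M t + e]. *)
pose M' u := if seq.filter D (prefixes u) is t :: _ then K t u else M u + e%:E.
have M'0 u t r : seq.filter D (prefixes u) = t :: r -> D t.
  by move=> ur; have := mem_head t r; rewrite -ur mem_filter => /andP[].
have M'le u : seq.filter D (prefixes u) = [::] -> forall x,
    M' (rcons u x) <= M (rcons u x) + e%:E.
  move=> u0 x; rewrite /M' prefixes_rcons filter_rcons u0.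
  by case: ifP => //= Dux; have [] := KP _ Dux.
have bM' u : (Num.min m (c + e)%R)%:E <= M' u.
  rewrite /M'; case ur: seq.filter => [|t r].
    by rewrite EFin_min ge_min EFinD leeD2r ?orbT.
  by have [_ mK _ _] := KP t (M'0 _ _ _ ur); rewrite EFin_min ge_min mK.
(* A prefix of [s] lying in [D] also extends [s], hence equals [s]. *)
have M's : M' s <= M s + e%:E.
  rewrite /M'; case sr: seq.filter => [|t r] //; have Dt := M'0 _ _ _ sr.
  have : t \in prefixes s.
    by have := mem_head t r; rewrite -sr mem_filter => /andP[].
  move=> /mapP[n _ tE]; have := Ds t Dt; rewrite prefixE take_oversize; last first.
    by rewrite tE size_take_min geq_minr.
  by move=> /eqP ts; rewrite {1}ts -{2}ts; have [] := KP t Dt; rewrite ts.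
apply: le_trans (M's); apply: game_upper_le.
- move=> u; rewrite {2}/M'; case ur: seq.filter => [|t r].
    apply: (@le_trans _ _ (Q u (fun x => 1%:E * M (rcons u x) + e%:E))).
      apply: (ue_monotone (hQ u)).
      + by exists (Num.min m (c + e))%R.
      + by exists (c + e)%R => x; rewrite mul1e EFinD leeD2r.
      + by move=> x; rewrite mul1e M'le.
    rewrite -[M u]mul1e; exact: (@supermartingale_affine M 1 e).
  (* After the switch, longer situations keep the same first entry [t]. *)
  rewrite (_ : (fun x => _) = fun x => K t (rcons u x)).
    by have [] := KP t (M'0 _ _ _ ur).
  apply/funext => x; rewrite /M' prefixes_rcons filter_rcons ur.
  by case: ifP.
- by exists (Num.min m (c + e))%R.
- move=> w sw; have [nD|] := pselect (forall n, ~~ D (prefix_of_path w n)).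
    apply: le_trans (fM w sw nD) _; apply: near_le_limn_einf; apply: nearW => n.
    rewrite /M' prefixes_path (_ : seq.filter _ _ = [::]).
      by rewrite leeDl// lee_fin ltW.
    apply: size0nil; apply/eqP; rewrite size_filter -leqn0 leqNgt -has_count.
    by apply/hasPn => _ /mapP[k _ ->]; exact: nD.
  move=> /existsNP[n0 /negP/negPn Dn0].
  have : prefix_of_path w n0 \in seq.filter D (prefixes (prefix_of_path w n0)).
    by rewrite mem_filter Dn0 prefixes_path mkseqS mem_rcons mem_head.
  case n0r: seq.filter => [//|t r] _.
  have Dt := M'0 _ _ _ n0r.
  have [k tE] : exists k, t = prefix_of_path w k.
    have : t \in prefixes (prefix_of_path w n0).
      by have := mem_head t r; rewrite -n0r mem_filter => /andP[].
    by rewrite prefixes_path => /mapP[k _ ->]; exists k.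
  have [_ _ _ fK] := KP t Dt.
  apply: le_trans (fK w _) _; first by rewrite tE /cylinder /= size_mkseq.
  apply: near_le_limn_einf; exists n0 => // n /= /subnKC <-.
  rewrite /M'; suff [r' ->] : exists r',
      seq.filter D (prefixes (prefix_of_path w (n0 + (n - n0)))) = t :: r' by [].
  elim: (n - n0)%N => [|j [r' IH]]; first by exists r; rewrite addn0.
  rewrite addnS /prefix_of_path mkseqS prefixes_rcons filter_rcons IH.
  by case: ifP => _; eexists.
Qed.


End Supermartingales.

(** * Levy's zero-one law and continuity along nondecreasing sequences *)

Section Continuity.
Context (R : realType) (X : finType) (Q : seq X -> (X -> \bar R) -> \bar R).
Context (hX : (0 < #|X|)%N) (hQ : imprecise_probabilities_tree Q).
Implicit Types (s t u : seq X) (w : path_space X).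
Implicit Types (f g h : path_space X -> \bar R).

Local Notation E := (game_upper_expectation Q).

Section Upcrossing.
Context (f h : path_space X -> \bar R) (m a b : R).
Context (ma : (m < a)%R) (ab : (a < b)%R) (mf : forall w, m%:E <= f w)
  (h0 : forall w, 0 <= h w)
  (h_off : forall w,
    ~ (liminf_along (E f) w < a%:E /\ b%:E < f w) -> h w = 0).

Let r := ((a - m) / (b - m))%R.

Let bm : (0 < b - m)%R. Proof. by rewrite subr_gt0 (lt_trans ma). Qed.

(* From a situation [t] with [E f t < a], the strategy that superhedges [f] is
   followed until its value exceeds [b]. *)
Lemma upcrossing_local (c : R) t : (0 < c)%R -> (forall u, E h u <= c%:E) ->
  E f t < a%:E -> E h t <= (r * c)%:E.
Proof.
move=> c0 hc fta.
have [K [smK mK Kt fK]] := game_upper_ltP hX hQ mf fta.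
(* The scaling makes [N], which is [l (K - m)], equal to 0 at level [m] and to [c] at level [b]; its
   value at [t] is below [l (a - m) = r c]. *)
pose l := (c / (b - m))%R; have l0 : (0 < l)%R by rewrite divr_gt0.
have bK : bounded_below_by_real K by exists m.
pose N u := l%:E * K u + (- (l * m))%:E.
have N0 u : 0 <= N u.
  apply: (@le_trans _ _ (l%:E * m%:E + (- (l * m))%:E)).
    by rewrite -EFinM -EFinD subrr.
  by rewrite leeD2r// lee_pmul2l.
apply: (@le_trans _ _ (N t)); last first.
  apply: (@le_trans _ _ (l%:E * a%:E + (- (l * m))%:E)).
    by rewrite leeD2r// lee_pmul2l// ltW.
  by rewrite -EFinM -EFinD lee_fin -mulrBr /l mulrAC [(r * c)%R]mulrC /r mulrA.
apply: (@game_upper_le_cut _ _ _ hX hQ h t N (fun u => prefix t u && (b%:E < K u)) 0%R).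
- exact: h0.
- exact: supermartingale_affine.
- exact: bounded_below_affine.
- by move=> u /andP[].
- move=> u /andP[_ bKu]; apply: le_trans (hc u) _.
  apply: (@le_trans _ _ (l%:E * b%:E + (- (l * m))%:E)).
    by rewrite -EFinM -EFinD lee_fin -mulrBr /l divfK ?lt0r_neq0.
  by rewrite leeD2r// lee_pmul2l// ltW.
(* If [K] never exceeds [b] along [w], then [f w <= b], so [w] is off the event and [h w] is 0. *)
- move=> w tw nD; rewrite h_off.
    rewrite -[leLHS](@limn_einf_cst R); apply: near_le_limn_einf.
    by apply: nearW => n; exact: N0.
  move=> [_]; apply/negP; rewrite -leNgt; apply: le_trans (fK w tw) _.
  rewrite -[leRHS](@limn_einf_cst R); apply: near_le_limn_einf.
  exists (size t) => // n /= tn; rewrite leNgt.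
  by have := nD n; rewrite (prefix_of_cylinder tw tn).
Qed.

(** The constant [r * c] is held until [E f] first drops below [a], where [upcrossing_local] takes
    over. On a path without such a drop the limit inferior of [E f] is at least [a], so [h] is 0. *)
Lemma upcrossing_contract (c : R) t : (0 < c)%R -> (forall u, E h u <= c%:E) ->
  E h t <= (r * c)%:E.
Proof.
move=> c0 hc; have r0 : (0 <= r)%R by rewrite divr_ge0 ?(ltW bm)// subr_ge0 ltW.
apply: (@game_upper_le_cut _ _ _ hX hQ h t (fun=> (r * c)%:E)
  (fun u => prefix t u && (E f u < a%:E)) 0%R).
- exact: h0.
- exact: (@supermartingale_cst _ _ _ hQ (r * c)%R%:E (ltNyr _)).
- by exists (r * c)%R.
- by move=> u /andP[].
- by move=> u /andP[_ /(upcrossing_local c0 hc)].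
- move=> w tw nD; rewrite h_off.
    by rewrite /liminf_along limn_einf_cst lee_fin mulr_ge0// ltW.
  move=> [+ _]; apply/negP; rewrite -leNgt.
  rewrite -[leLHS](@limn_einf_cst R); apply: near_le_limn_einf.
  exists (size t) => // n /= tn; rewrite leNgt.
  by have := nD n; rewrite (prefix_of_cylinder tw tn).
Qed.

(** The bound [y] makes the supremum [S] of [E h] over all situations finite. If [S] were positive,
    contraction would give [S <= r S] with [r < 1]. *)
Lemma upcrossing_null (y : R) s : (forall w, h w <= y%:E) -> E h s <= 0.
Proof.
move=> hy; pose S := ereal_sup (range (E h)).
have hS u : E h u <= S by apply: ereal_sup_ubound; exists u.
have S0 : 0 <= S by apply: le_trans (hS s); exact: game_upper_ge.
have Sy : S <= y%:E.
  by apply: ge_ereal_sup => _ [u _ <-]; apply: (game_upper_le_cst hQ (ltNyr _)).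
apply: le_trans (hS s) _; move: hS S0 Sy; case SE : S => [c| |] // hS _ _.
rewrite lee_fin leNgt; apply/negP => c0.
have : S <= (r * c)%:E.
  by apply: ge_ereal_sup => _ [u _ <-]; exact: upcrossing_contract.
rewrite SE lee_fin leNgt => /negP; apply.
by rewrite gtr_pMl// ltr_pdivrMr// mul1r ltrD2r.
Qed.

End Upcrossing.

(** Superhedges [T n] with initial values below [e / 2^(n+1)] are added up. The supremum of the
    partial sums is a supermartingale that dominates every [T n] and starts at most at [e]. *)
Lemma game_upper_sup_null (f : nat -> path_space X -> \bar R) s :
  (forall n w, 0 <= f n w) -> (forall n, E (f n) s <= 0) ->
  E (fun w => ereal_sup (range (fun n => f n w))) s <= 0.
Proof.
move=> f0 Ef0; apply/lee_addgt0Pr => /= e e0; rewrite add0e.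
pose d n := (e / (2 ^ n.+1)%:R)%R.
have d0 n : (0 < d n)%R by rewrite divr_gt0// ltr0n expn_gt0.
have [T TP] := choice (fun n =>
  game_upper_ltP hX hQ (f0 n) (le_lt_trans (Ef0 n) (d0 n : 0 < (d n)%:E))).
have T0 n u : 0 <= T n u by have [_ + _ _] := TP n; exact.
pose M n u := \sum_(0 <= k < n) T k u.
have M0 n u : 0 <= M n u by apply: sume_ge0.
have MS n u : M n.+1 u = M n u + T n u by rewrite /M big_nat_recr.
have smM n : supermartingale Q (M n).
  elim: n => [|n IH].
    rewrite (_ : M 0%N = fun=> 0); first exact: (@supermartingale_cst _ _ _ hQ 0%R%:E (ltNyr _)).
    by apply/funext => u; rewrite /M big_geq.
  rewrite (_ : M n.+1 = fun u => M n u + T n u); last exact/funext.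
  by apply: supermartingale_add => //; [exists 0%R|exists 0%R|case: (TP n)].
pose Moo u := ereal_sup (range (fun n => M n u)).
have TM n u : T n u <= Moo u.
  apply: le_ereal_sup_tmp; exists (M n.+1 u); first by exists n.+1.
  by rewrite MS leeDr.
apply: (@le_trans _ _ (Moo s)).
  apply: game_upper_le.
  - apply: (@supermartingale_sup _ _ _ _ _ 0%R) => // n u.
    by rewrite MS leeDl.
  - by exists 0%R => u; exact: le_trans (T0 0%N u) (TM 0%N u).
  - move=> w sw; apply: ge_ereal_sup => _ [n _ <-].
    have [_ _ _ fT] := TP n; apply: le_trans (fT w sw) _.
    by apply: near_le_limn_einf; apply: nearW => k; exact: TM.
apply: ge_ereal_sup => _ [n _ <-].
apply: le_trans (epsilon_trick0 xpredT (ltW e0)).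
apply: le_trans (nneseries_lim_ge n _); last by move=> k _ _; rewrite lee_fin; exact: ltW (d0 k).
by apply: lee_sum => k _; apply: ltW; case: (TP k).
Qed.

(* The exceptional paths are covered by the countably many upcrossing events
   with rational levels; the weights [j] make the supremum infinite on them. *)
Lemma game_upper_levy f (m : R) s : (forall w, m%:E <= f w) ->
  E (fun w => if liminf_along (E f) w < f w then +oo else 0) s <= 0.
Proof.
move=> mf.
pose N (a b : R) w :=
  [&& (m < a)%R, (a < b)%R, liminf_along (E f) w < a%:E & b%:E < f w].
pose h (p : rat * rat * nat) w : \bar R :=
  if N (ratr p.1.1) (ratr p.1.2) w then p.2%:R%:E else 0.
pose hn n w := if unpickle n is Some p then h p w else 0.
have h0 p w : 0 <= h p w by rewrite /h; case: ifP => // _; rewrite lee_fin.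
have hn0 n w : 0 <= hn n w by rewrite /hn; case: unpickle.
have Eh p : E (h p) s <= 0.
  case: p => [[a b] j].
  have [/andP[ma ab]|nab] := boolP ((m < ratr a)%R && (ratr a < ratr b :> R)%R).
    apply: (@upcrossing_null f _ m (ratr a) (ratr b) ma ab mf _ _ j%:R) => //.
    - move=> w nN; rewrite /h /N /=; case: ifP => // /and4P[_ _ fa bf].
      by exfalso; exact: nN.
    - by move=> w; rewrite /h; case: ifP => //; rewrite lee_fin.
  apply: (game_upper_le_cst hQ (ltNyr _)) => // w _; rewrite /h /N /= andbA (negbTE nab).
  exact: lexx.
have Ehn n : E (hn n) s <= 0.
  rewrite /hn; case: unpickle => [p|]; first exact: Eh.
  exact: (game_upper_le_cst hQ (ltNyr 0%R)).
apply: le_trans (game_upper_sup_null hn0 Ehn).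
apply: game_upper_mono => w _; set S := ereal_sup _.
have hS p : h p w <= S.
  by apply: ereal_sup_ubound; exists (pickle p); rewrite // /hn pickleK.
case: ifPn => [|_]; last by apply: le_trans (hS (0%R, 0%R, 0%N)).
move=> /rat_between_ereal[a /andP[fa /rat_between_ereal[b /andP[ab bf]]]].
(* [E f] is at least [m] everywhere, hence so is its limit inferior along [w], which lies below
   [a]. *)
have ma : (m < ratr a)%R.
  rewrite -lte_fin; apply: le_lt_trans fa.
  rewrite -[leLHS](@limn_einf_cst R); apply: near_le_limn_einf.
  by apply: nearW => n; exact: game_upper_ge.
have jS (j : nat) : j%:R%:E <= S.
  have := hS (a, b, j); rewrite /h /N /= ma fa bf !andbT.
  by rewrite lte_fin in ab; rewrite ab.
case: S jS {hS} => [x| |] jS //; last by have := jS 0%N.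
have := jS (Num.bound x); rewrite lee_fin leNgt => /negP[].
by apply: archi_boundP; have := jS 0%N; rewrite lee_fin.
Qed.

Lemma game_upper_nondecreasing (g : nat -> path_space X -> \bar R) (m : R) s :
  (forall n w, m%:E <= g n w) -> (forall n w, g n w <= g n.+1 w) ->
  E (fun w => ereal_sup (range (fun n => g n w))) s <=
  ereal_sup (range (fun n => E (g n) s)).
Proof.
(* [h n] is infinite exactly on the paths where Levy's inequality fails for [g n]. A single [T] with
   [T s < e] hedges all these maps at once. *)
move=> mg gnd; apply/lee_addgt0Pr => /= e e0.
pose h n w : \bar R := if liminf_along (E (g n)) w < g n w then +oo else 0.
have h0 n w : 0 <= h n w by rewrite /h; case: ifP.
have Eh : E (fun w => ereal_sup (range (fun n => h n w))) s < e%:E.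
  apply: le_lt_trans (game_upper_sup_null h0 _) _; last by rewrite lte_fin.
  by move=> n; apply: game_upper_levy; exact: mg.
have [|T [smT T0 Ts hT]] := game_upper_ltP hX hQ (m := 0%R) _ Eh.
  by move=> w; apply: le_ereal_sup_tmp; exists (h 0%N w) => //; exists 0%N.
pose c u := ereal_sup (range (fun n => E (g n) u)).
have cE n u : E (g n) u <= c u by apply: ereal_sup_ubound; exists n.
have mE n u : m%:E <= E (g n) u by apply: game_upper_ge.
have mc u : m%:E <= c u by exact: le_trans (mE 0%N u) (cE 0%N u).
have smc : supermartingale Q c.
  apply: (@supermartingale_sup _ _ _ _ (fun n u => E (g n) u) m) => //.
    by move=> n; exact: (game_upper_supermartingale hX hQ (mg n)).
  by move=> n u; exact: game_upper_mono.
apply: (@le_trans _ _ (c s + T s)); last by rewrite leeD2l// ltW.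
apply: (@game_upper_le _ _ _ _ _ (fun u => c u + T u)).
- by apply: supermartingale_add => //; [exists m|exists 0%R].
- by exists m => u; rewrite -[leLHS]adde0 leeD.
- move=> w sw.
  have [gc|] := pselect (forall n, g n w <= liminf_along (E (g n)) w).
    apply: ge_ereal_sup => _ [n _ <-]; apply: le_trans (gc n) _.
    apply: near_le_limn_einf; apply: nearW => k.
    by rewrite -[leLHS]adde0 leeD.
  move=> /existsNP[n /negP]; rewrite -ltNge => gn.
  have Too : liminf_along T w = +oo.
    apply/eqP; rewrite -leye_eq; apply: le_trans (hT w sw).
    by apply: ereal_sup_ubound; exists n => //; rewrite /h gn.
  (* On an exceptional path only [c >= m] is known, but [T] tends to +oo and carries the sum with
     it. *)
  apply: (@le_trans _ _ (limn_einf (fun k => m%:E + T (prefix_of_path w k)))).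
    by rewrite limn_einf_shift// [limn_einf _]Too addey// leey.
  by apply: near_le_limn_einf; apply: nearW => k; rewrite leeD2r.
Qed.

End Continuity.

Theorem corollary25 (R : realType) (X : finType) (hX : (0 < #|X|)%N)
    (Q : seq X -> (X -> \bar R) -> \bar R)
    (hQ : imprecise_probabilities_tree Q)
    (s : seq X) (f_ : nat -> path_space X -> \bar R)
    (hf_ : forall n, bounded_below_by_real (f_ n))
    (hunif : exists M : R, forall n w, M%:E <= f_ n w) :
  game_upper_expectation Q (fun w => limn_einf (fun n => f_ n w)) s
    <= limn_einf (fun n => game_upper_expectation Q (f_ n) s).
Proof.
have [m mf] := hunif.
pose g n w := einfs (fun k => f_ k w) n.
rewrite (_ : (fun w => _) = fun w => ereal_sup (range (fun n => g n w))).
  apply: le_trans (@game_upper_nondecreasing _ _ _ hX hQ g m s _ _) _.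
  - by move=> n w; apply: le_ereal_inf_tmp => _ [k _ <-].
  - by move=> n w; exact: nondecreasing_einfs.
  (* The right side is a supremum of tail infima, so it is enough to compare [E (g n)] at [s] with
     the [n]-th of them. *)
  rewrite limn_einfE; apply: ge_ereal_sup => _ [n _ <-].
  apply: le_ereal_sup_tmp.
  exists (einfs (fun k => game_upper_expectation Q (f_ k) s) n); first by exists n.
  apply: le_ereal_inf_tmp => _ [k /= nk <-]; apply: game_upper_mono => w _.
  by apply: ereal_inf_lbound; exists k.
by apply/funext => w; rewrite limn_einfE.
Qed.
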